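(* For all $n\ge1$, $$w(\bar D_{2n})=\frac{2}{4^n\,n!},\qquad w(\bar D_{2n+1})=\frac1{\sqrt\pi}\cdot\frac1{2^{n-1}(2n+1)!!}.$$ In particular $w(\bar D_k)\neq0$ for all $k\ge2$.
   Context: $\mathcal A$ is the free associative $\mathbb R$-algebra of noncommutative polynomials in two symbols $N$ (degree 1) and $\Delta$ (degree 2). Every $A\in\mathcal A$ homogeneous of degree $\ge1$ is uniquely written $A=\bar AN+\tilde A\Delta$ with $\bar A,\tilde A\in\mathcal A$. The weight $w:\mathcal A\to\mathbb R$ is the algebra homomorphism with $w(I)=1$, $w(N)=2$, $w(\Delta)=-1$. Define $R_{kj},S_{kj}$ ($k,j$ integers): $R_{00}=I$, $S_{00}=0$, $R_{kj}=S_{kj}=0$ if $k<0$ or $j<0$, otherwise $R_{kj}=-(N^2+\Delta)R_{k-1,j}+NS_{k-1,j}$, $S_{kj}=\Delta NR_{k-1,j}-\Delta S_{k-1,j}+NR_{k-1,j-1}$. Let $\{a,b\}=\frac{\Gamma(a+b+\frac12)}{(a+b)!\Gamma(a+\frac12)}$, $Z_{n+1}=\sum_{j=0}^n\{n+1,j-1\}R_{n+j,j}$, $\alpha_n=\sum_{j=0}^{n+1}\{n,j\}S_{n+j,j}$. The heat content operators are $D_1=\frac2{\sqrt\pi}I$ and for $n\ge1$: $D_{2n}=\frac1{\sqrt\pi}\sum_{i=1}^n\frac{\Gamma(i+\frac12)\Gamma(n-i+\frac12)}{n!}D_{2i-1}\alpha_{n-i}$, $D_{2n+1}=\frac1{\sqrt\pi}Z_{n+1}+\frac1{\sqrt\pi}\sum_{i=1}^n\frac{i!\Gamma(n-i+\frac12)}{\Gamma(n+\frac32)}D_{2i}\alpha_{n-i}$.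 $D_k$ is homogeneous of degree $k-1$. *)

(* Defs.v *)
From HB Require Import structures.
From Stdlib Require Import Reals.
From mathcomp Require Import all_boot all_order all_algebra.
From mathcomp Require Import Rstruct finmap.
From mathcomp.multinomials Require Import monalg.

Set Implicit Arguments.
Unset Strict Implicit.
Unset Printing Implicit Defensive.

Import Order.TTheory GRing.Theory Num.Theory.
Local Open Scope ring_scope.

(* Words in the two symbols: [true] stands for N, [false] for Delta.
   The free monoid on {N, Delta} is {fmonom bool}; the free associative
   R-algebra A of noncommutative polynomials is its monoid algebra. *)
Definition ncA := {malg R[{fmonom bool}]}.

Definition wordN : {fmonom bool} := fmu true.
Definition wordD : {fmonom bool} := fmu false.

Definition symN : ncA := << wordN >>.
Definition symD : ncA := << wordD >>.

(* bar part: A = bar A * N + tilde A * Delta, i.e. bar A collects the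
   words ending with N, with that final N removed. *)
Definition ncbar (A : ncA) : ncA :=
  \sum_(k <- msupp A)
     match rev (fmonom_val k) with
     | true :: u => << A@_k *g FMonom (rev u) >>
     | _ => 0
     end.

(* weight: the algebra homomorphism with w(I)=1, w(N)=2, w(Delta)=-1 *)
Definition letter_weight (x : bool) : R := if x then 2 else -1.
Definition ncw (A : ncA) : R :=
  \sum_(k <- msupp A) A@_k * \prod_(x <- fmonom_val k) letter_weight x.

Fixpoint RS (k j : nat) : ncA * ncA :=
  match k with
  | 0%N => if j == 0%N then (1, 0) else (0, 0)
  | k'.+1 =>
      let r := (RS k' j).1 in
      let s := (RS k' j).2 in
      let r1 := if j is j'.+1 then (RS k' j').1 else 0 in
      (- (symN * symN + symD) * r + symN * s,
       symD * symN * r - symD * s + symN * r1)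
  end.
Definition Rkj k j := (RS k j).1.
Definition Skj k j := (RS k j).2.

(* Gamma function at half-integers: gammah m = Gamma(m + 1/2), determined by
   Gamma(1/2) = sqrt pi and Gamma(x+1) = x Gamma(x). *)
Fixpoint gammah (m : nat) : R :=
  match m with
  | 0%N => sqrt PI
  | m'.+1 => (m'%:R + 2^-1) * gammah m'
  end.

(* {a,b} = Gamma(a+b+1/2) / ((a+b)! Gamma(a+1/2)), for a >= 0 and a+b >= 0 *)
Definition brace (a : nat) (b : int) : R :=
  let s := `|(a%:Z + b)%R|%N in
  gammah s / ((s`!)%:R * gammah a).

Definition Zop (m : nat) : ncA := (* Z_{n+1} with m = n+1 *)
  \sum_(0 <= j < m) brace m (j%:Z - 1) *: Rkj (m.-1 + j) j.

Definition alpha (n : nat) : ncA :=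
  \sum_(0 <= j < n.+2) brace n j%:Z *: Skj (n + j) j.

(* Dall n = [:: D_1; D_2; ...; D_{2n+1}] *)
Fixpoint Dall (n : nat) : seq ncA :=
  match n with
  | 0%N => [:: (2 / sqrt PI) *: 1]
  | n'.+1 =>
      let m := n'.+1 in
      let L := Dall n' in
      let D2m : ncA :=
        (sqrt PI)^-1 *:
          \sum_(1 <= i < m.+1)
             ((gammah i * gammah (m - i)) / (m`!)%:R) *:
               (nth 0 L (2 * i - 2) * alpha (m - i)) in
      let L' := rcons L D2m in
      let D2m1 : ncA :=
        (sqrt PI)^-1 *: Zop m.+1 +
        (sqrt PI)^-1 *:
          \sum_(1 <= i < m.+1)
             (((i`!)%:R * gammah (m - i)) / gammah m.+1) *:
               (nth 0 L' (2 * i - 1) * alpha (m - i)) in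
      rcons L' D2m1
  end.

Definition Dop (k : nat) : ncA := nth 0 (Dall k) k.-1.

Fixpoint dfact (n : nat) : nat :=
  match n with
  | 0%N | 1%N => 1%N
  | (k.+2) as n' => (n' * dfact k)%N
  end.

(* Main.v *)
(* Write Den = (1+x)^2 - 4 x^2 y. Applying w to the recursions gives
   sum w(R_kj) x^k y^j = (1-x)/Den and sum w(S_kj) x^k y^j = 2x(y-1)/Den, and
   the barred weights are, up to a constant term, (1-x)/2 times these. So every
   weight is a combination of shifts of the numbers (-1)^k 4^j C(k, 2j+1).
   Since Gamma(k+1/2)/k! = sqrt(pi) C(2k,k)/4^k, the trinomial identity
   C(2k,k) C(k,l) = C(2k,M) C(M,k) (l + M = 2k) turns the sums defining
   alpha_n and Z_{n+1} into sums over k of (-1)^k C(N,k) C(2k,M), i.e. into N-th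
   differences of polynomials of degree at most N. One finds w(alpha_n) = [n=0]
   and w(Z_{n+1}) = 2[n=0], hence w(D_2n) = 1/n! and
   w(D_{2n+1}) = 1/Gamma(n+3/2), while Gamma(n+1/2) w(bar alpha_n) equals
   sqrt(pi) (2[n=0] - (3/2) 4^-n), so that the sums for w(bar D_k) are
   geometric. *)
From HB Require Import structures.
Require Import Defs.
From Stdlib Require Import Reals.
From mathcomp Require Import all_boot all_order all_algebra.
From mathcomp Require Import Rstruct finmap.
From mathcomp.multinomials Require Import monalg.
From mathcomp Require Import zify ring.
Import Order.TTheory GRing.Theory Num.Theory.
Local Open Scope ring_scope.

(** * Binomial sums *)

(** Both sides equal the trinomial coefficient (a+b)! / (a! l! (b-l)!); if b < l, then M < a and
    both vanish. *)
Lemma bin_trinomial (a b l M : nat) : (l + M = a + b)%N ->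
  ('C(a + b, a) * 'C(b, l) = 'C(a + b, M) * 'C(M, a))%N.
Proof.
move=> eqM; have [lt_bl|le_lb] := ltnP b l.
  by rewrite (bin_small lt_bl) (@bin_small M a) ?muln0 //; lia.
have eM : M = (a + (b - l))%N by lia.
have eqfact (p q : nat) : ('C(p + q, p) * (p`! * q`!) = (p + q)`!)%N.
  by rewrite -{2}(addKn p q) bin_fact ?leq_addr.
have p1 := eqfact a b; have p3 := eqfact M l; have p4 := eqfact a (b - l)%N.
have p2 : ('C(b, l) * (l`! * (b - l)`!) = b`!)%N by rewrite bin_fact.
rewrite addnC eqM in p3; rewrite -eM in p4.
have := fact_gt0 a; have := fact_gt0 l; have := fact_gt0 (b - l).
move=> h1 h2 h3.
apply/eqP; rewrite -(@eqn_pmul2r (a`! * l`! * (b - l)`!)) ?muln_gt0 ?h1 ?h2 ?h3 //.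
apply/eqP; transitivity (a + b)`!; first by rewrite -p1 -p2; ring.
by rewrite -p3 -p4; ring.
Qed.

(** Pascal's rule and summation by parts: an (N+1)-st difference is the N-th difference of a first
    difference. *)
Lemma altsum_binS (A : pzRingType) (f : nat -> A) (N : nat) :
  \sum_(0 <= i < N.+2) (-1) ^+ i * 'C(N.+1, i)%:R * f i =
  \sum_(0 <= i < N.+1) (-1) ^+ i * 'C(N, i)%:R * (f i - f i.+1).
Proof.
rewrite big_nat_recl // bin0.
under eq_bigr => i _ do rewrite binS natrD mulrDr mulrDl.
rewrite big_split /= addrA.
under [RHS]eq_bigr => i _ do rewrite mulrBr.
rewrite sumrB; congr (_ + _).
  rewrite [LHS]addrC big_nat_recr //= bin_small // mulr0 mul0r addr0.
  by rewrite [RHS]big_nat_recl // bin0 addrC.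
by rewrite -sumrN; apply: eq_bigr => i _; rewrite exprS !mulN1r !mulNr.
Qed.

(* The N-th difference, with step 2, of a polynomial of degree M <= N. *)
Lemma altsum_bin_bin (N a M : nat) : (M <= N)%N ->
  \sum_(0 <= i < N.+1) (-1) ^+ i * 'C(N, i)%:R * 'C(a + 2 * i, M)%:R =
  (if M == N then (- 2) ^+ N else 0) :> R.
Proof.
elim: N a M => [|N IH] a M leMN.
  move: leMN; rewrite leqn0 => /eqP ->.
  by rewrite big_nat1 !bin0 !expr0 !mulr1.
rewrite altsum_binS.
case: M leMN => [|M] leMN.
  by rewrite big1 // => i _; rewrite !bin0 subrr mulr0.
(* Pascal's rule twice: the difference is minus two binomials of degree M. By induction both give
   the same sum, whence one factor -2 per step. *)
have step i : 'C(a + 2 * i, M.+1)%:R - 'C(a + 2 * i.+1, M.+1)%:R =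
    - 'C(a + 2 * i, M)%:R - 'C(a.+1 + 2 * i, M)%:R :> R.
  have -> : (a + 2 * i.+1 = (a + 2 * i).+2)%N by lia.
  rewrite addSn [in X in _ - X = _]binS [in X in _ - X = _]binS !natrD.
  by ring.
under eq_bigr => i _ do rewrite step mulrBr mulrN.
rewrite sumrB sumrN !IH // eqSS; case: eqP => _; last by rewrite oppr0 addr0.
by rewrite exprS; ring.
Qed.

(** With k = i + 1 this is minus the sum of [altsum_bin_bin] for a = -1, deprived of its term k = 0.
    That term would be C(-1,M) = (-1)^M. Induction on M through C(2k,M+1) = C(2k-1,M+1) + C(2k-1,M)
    avoids the negative upper index. *)
Lemma altsum_bin_bin_pred (N M : nat) : (0 < N)%N -> (M <= N)%N ->
  \sum_(0 <= i < N) (-1) ^+ i * 'C(N, i.+1)%:R * 'C((2 * i).+1, M)%:R =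
  (-1) ^+ M - (if M == N then (- 2) ^+ N else 0) :> R.
Proof.
move=> N_gt0; elim: M => [|M IH] leMN.
  have := altsum_bin_bin N 0 0 (leq0n N).
  rewrite big_nat_recl // !bin0 expr0 !mulr1 => <-.
  rewrite opprD addNKr -sumrN; apply: eq_bigr => i _.
  by rewrite !bin0 exprS; ring.
have := altsum_bin_bin N 0 M.+1 leMN.
rewrite big_nat_recl // muln0 addn0 (bin_small (ltn0Sn M)) mulr0 add0r => <-.
have IHM := IH (ltnW leMN); rewrite (ltn_eqF leMN) subr0 in IHM.
rewrite exprS -IHM mulN1r -opprD -big_split /= -sumrN; apply: eq_bigr => i _.
have -> : (0 + 2 * i.+1 = (2 * i).+2)%N by lia.
by rewrite [X in _ = - (_ + _ * X%:R)]binS natrD exprS; ring.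
Qed.

(** * Half-integer Gamma quotients and sums along the diagonals k = n + j *)

Definition arcsine_moment (k : nat) : R := (gammah k / (k`!)%:R)%R.

Lemma sqrt_PI_neq0 : sqrt PI != 0.
Proof. by apply/eqP => /sqrt_eq_0 h; apply: PI_neq0; apply: h; left; exact: PI_RGT_0. Qed.

#[local] Arguments gammah : simpl never.

Lemma gammahS (k : nat) : gammah k.+1 = (k%:R + 2^-1) * gammah k.
Proof. by []. Qed.

Lemma gammah_neq0 (k : nat) : gammah k != 0.
Proof.
elim: k => [|k IH]; first exact: sqrt_PI_neq0.
by rewrite gammahS mulf_neq0 // gt_eqF // ltr_wpDl // invr_gt0.
Qed.

Lemma fact_neq0 (k : nat) : (k`!)%:R != 0 :> R.
Proof. by rewrite pnatr_eq0 -lt0n fact_gt0. Qed.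

(** C(2k,k) / 4^k is the k-th moment of the arcsine law on [0,1]. From k to k + 1 both sides are
    multiplied by (k + 1/2) / (k + 1). *)
Lemma arcsine_momentE (k : nat) :
  arcsine_moment k = sqrt PI * 'C(2 * k, k)%:R / 4 ^+ k.
Proof.
rewrite /arcsine_moment; elim: k => [|k IH].
  by rewrite muln0 bin0 mulr1.
have k1 : k.+1%:R != 0 :> R by rewrite pnatr_eq0.
have k0 := fact_neq0 k.
have bin_step : k.+1%:R * 'C(2 * k.+1, k.+1)%:R =
    2 * (2 * k.+1%:R - 1) * 'C(2 * k, k)%:R :> R.
  have h1 := mul_bin_diag (2 * k).+2 k.
  have h2 := mul_bin_down (2 * k).+1 k.
  have e1 : (2 * k.+1 = (2 * k).+2)%N by lia.
  have e2 : ((2 * k).+1 - k = k.+1)%N by lia.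
  rewrite e2 /= in h2; rewrite /= in h1.
  have h1' : (k.+1 * 'C((2 * k).+2, k.+1) = 2 * (k.+1 * 'C((2 * k).+1, k)))%N.
    by rewrite -h1; lia.
  rewrite e1 -natrM h1' -h2 !natrM -[(2 * k).+1%:R]natr1 natrM.
  by rewrite -[k.+1%:R]natr1; ring.
have -> : 'C(2 * k.+1, k.+1)%:R =
    2 * (2 * k.+1%:R - 1) * 'C(2 * k, k)%:R / k.+1%:R :> R.
  by rewrite -bin_step mulrAC mulfV // mul1r.
have -> : gammah k.+1 = (k%:R + 2^-1) * (gammah k / (k`!)%:R) * (k`!)%:R.
  by rewrite -mulrA divfK.
rewrite IH factS natrM exprS -natr1.
have k1' : 1 + k%:R != 0 :> R by rewrite nat1r.
have p0 : 4 ^+ k != 0 :> R by rewrite expf_neq0 // pnatr_eq0.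
by field; rewrite p0 k0 k1'.
Qed.

(* The symbol weights are w(R_kj) = wcoef k j - wcoef k+1 j and
   w(S_kj) = 2 (wcoef k j - wcoef k j-1): with Den = (1+x)^2 - 4 x^2 y, the
   number - wcoef k j is the coefficient of x^k y^j in x / Den. *)
Definition wcoef (k j : nat) : R :=
  ((-1) ^+ k * 4 ^+ j * 'C(k, (2 * j).+1)%:R)%R.

(** Completes a sum along a diagonal to a full N-th difference. *)
Lemma sum_shift (F : nat -> R) (n B N : nat) : (n <= N < n + B)%N ->
  (forall k, (k < n)%N -> F k = 0) -> (forall k, (N < k)%N -> F k = 0) ->
  \sum_(0 <= j < B) F (n + j)%N = \sum_(0 <= k < N.+1) F k.
Proof.
move=> /andP[le_nN lt_NB] lo hi.
have -> : \sum_(0 <= j < B) F (n + j)%N = \sum_(n <= k < n + B) F k.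
  transitivity (\sum_(0 + n <= k < n + B) F k); last by [].
  by rewrite big_addn addKn; apply: eq_bigr => j _; rewrite addnC.
have zlo : \sum_(0 <= k < n) F k = 0.
  by rewrite big_nat_cond big1 // => k /andP[/andP[_ /lo]].
have zhi : \sum_(N.+1 <= k < n + B) F k = 0.
  by rewrite big_nat_cond big1 // => k /andP[/andP[/hi]].
rewrite -[LHS]add0r -{1}zlo -big_cat_nat ?leq_addr //.
by rewrite (@big_cat_nat _ _ _ N.+1) //= zhi addr0.
Qed.

Lemma sum_moment_wcoef (n B : nat) : (n <= B)%N ->
  \sum_(0 <= j < B) arcsine_moment (n + j) * wcoef (n + j) j =
  if n is 0 then 0 else - (sqrt PI / 2).
Proof.
case: n => [_|n le_nB].
  by rewrite big1 // => j _; rewrite /wcoef bin_small ?mulr0 //; lia.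
(* Here k = n + 1 + j and l = 2j + 1, so the trinomial identity has M = 2k - l = 2n + 1. Order and
   degree of the difference agree, and its value is (-2)^(2n+1). *)
pose F k : R := ((-1) ^+ k * 'C((2 * n).+1, k)%:R * 'C(0 + 2 * k, (2 * n).+1)%:R)%R.
have E (j : nat) : arcsine_moment (n.+1 + j) * wcoef (n.+1 + j) j =
    sqrt PI / 4 ^+ n.+1 * F (n.+1 + j)%N.
  have p0 k : 4 ^+ k != 0 :> R by rewrite expf_neq0 // pnatr_eq0.
  have tri : 'C(2 * (n.+1 + j), n.+1 + j)%:R * 'C(n.+1 + j, (2 * j).+1)%:R =
      'C(0 + 2 * (n.+1 + j), (2 * n).+1)%:R * 'C((2 * n).+1, n.+1 + j)%:R :> R.
    by rewrite -!natrM add0n mul2n -addnn (@bin_trinomial _ _ _ (2 * n).+1) //; lia.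
  rewrite arcsine_momentE /wcoef /F.
  transitivity (sqrt PI / 4 ^+ n.+1 * (-1) ^+ (n.+1 + j) *
    ('C(2 * (n.+1 + j), n.+1 + j)%:R * 'C(n.+1 + j, (2 * j).+1)%:R)).
    by rewrite [4 ^+ (_ + _)]exprD; field; rewrite !p0.
  by rewrite tri; ring.
under eq_bigr => j _ do rewrite E.
rewrite -big_distrr /= (@sum_shift F n.+1 B (2 * n).+1).
- rewrite altsum_bin_bin // eqxx.
  have -> : 4 ^+ n.+1 = 2 ^+ n.+1 * 2 ^+ n.+1 :> R.
    by rewrite -exprMn -natrM.
  have p0 k : 2 ^+ k != 0 :> R by rewrite expf_neq0 // pnatr_eq0.
  have -> : (- 2) ^+ (2 * n).+1 = - (2 ^+ n * 2 ^+ n.+1) :> R.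
    by rewrite exprS exprM sqrrN -exprM mul2n -addnn exprD !exprS; ring.
  by rewrite !exprS; field; rewrite ?p0.
- lia.
- by move=> k ltk; rewrite /F (@bin_small (0 + _)) ?mulr0 //; lia.
- by move=> k ltk; rewrite /F bin_small ?mulr0 ?mul0r //; lia.
Qed.

Lemma bin_central_half (k : nat) : 'C(2 * k.+1, k.+1) = (2 * 'C(k.+1 + k, k.+1))%N.
Proof.
have -> : (2 * k.+1 = (k.+1 + k).+1)%N by lia.
have e : 'C(k.+1 + k, k) = 'C(k.+1 + k, k.+1) by rewrite -bin_sub ?leq_addl // addnK.
by rewrite binS e mul2n addnn.
Qed.

Lemma sum_moment_bin (n B : nat) : (n < B)%N ->
  \sum_(0 <= j < B)
    arcsine_moment (n + j) * ((-1) ^+ (n + j) * 4 ^+ j * 'C(n + j, 2 * j)%:R) =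
  sqrt PI.
Proof.
move=> lt_nB.
pose F k : R := ((-1) ^+ k * 'C(2 * n, k)%:R * 'C(0 + 2 * k, 2 * n)%:R)%R.
have p0 k : 4 ^+ k != 0 :> R by rewrite expf_neq0 // pnatr_eq0.
have E (j : nat) :
    arcsine_moment (n + j) * ((-1) ^+ (n + j) * 4 ^+ j * 'C(n + j, 2 * j)%:R) =
    sqrt PI / 4 ^+ n * F (n + j)%N.
  have tri : 'C(2 * (n + j), n + j)%:R * 'C(n + j, 2 * j)%:R =
      'C(0 + 2 * (n + j), 2 * n)%:R * 'C(2 * n, n + j)%:R :> R.
    by rewrite -!natrM add0n mul2n -addnn (@bin_trinomial _ _ _ (2 * n)) //; lia.
  rewrite arcsine_momentE /F.
  transitivity (sqrt PI / 4 ^+ n * (-1) ^+ (n + j) *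
    ('C(2 * (n + j), n + j)%:R * 'C(n + j, 2 * j)%:R)).
    by rewrite [4 ^+ (_ + _)]exprD; field; rewrite !p0.
  by rewrite tri; ring.
under eq_bigr => j _ do rewrite E.
rewrite -big_distrr /= (@sum_shift F n B (2 * n)).
- rewrite altsum_bin_bin // eqxx.
  have -> : (- 2) ^+ (2 * n) = 4 ^+ n :> R by rewrite exprM; congr (_ ^+ _); ring.
  by rewrite divfK.
- lia.
- by move=> k ltk; rewrite /F (@bin_small (0 + _)) ?mulr0 //; lia.
- by move=> k ltk; rewrite /F bin_small ?mulr0 ?mul0r //; lia.
Qed.

(** Pascal's rule C(k+1,2j+1) = C(k,2j+1) + C(k,2j) reduces this to the two preceding sums. *)
Lemma sum_moment_wcoefS (n B : nat) : (n < B)%N ->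
  \sum_(0 <= j < B) arcsine_moment (n + j) * wcoef (n + j).+1 j =
  - (if n is 0 then sqrt PI else sqrt PI / 2).
Proof.
move=> lt_nB.
have E (j : nat) : arcsine_moment (n + j) * wcoef (n + j).+1 j =
    - (arcsine_moment (n + j) * wcoef (n + j) j
       + arcsine_moment (n + j) *
           ((-1) ^+ (n + j) * 4 ^+ j * 'C(n + j, 2 * j)%:R)).
  by rewrite /wcoef binS natrD exprS; ring.
under eq_bigr => j _ do rewrite E.
rewrite sumrN big_split /= sum_moment_bin // (sum_moment_wcoef _ _ (ltnW lt_nB)).
by case: n {lt_nB E} => [|n]; [rewrite add0r | field].
Qed.

(** As C(2k+2,k+1) = 2 C(2k+1,k+1), the trinomial identity applies with a = k + 1, b = k and M = 2n.
    The boundary term (-1)^M of [altsum_bin_bin_pred] is the source of the powers 4^-n in the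
    theorem. *)
Lemma sum_moment_wcoef_pred (n B : nat) : (n < B)%N ->
  \sum_(0 <= j < B) arcsine_moment (n + j).+1 * wcoef (n + j) j =
  sqrt PI * (2 / 4 ^+ n.+1 - 2^-1).
Proof.
move=> lt_nB.
pose F k : R := ((-1) ^+ k * 'C(2 * n, k.+1)%:R * 'C((2 * k).+1, 2 * n)%:R)%R.
have p0 k : 4 ^+ k != 0 :> R by rewrite expf_neq0 // pnatr_eq0.
have E (j : nat) : arcsine_moment (n + j).+1 * wcoef (n + j) j =
    2 * sqrt PI / 4 ^+ n.+1 * F (n + j)%N.
  have tri : 'C(2 * (n + j).+1, (n + j).+1)%:R * 'C(n + j, (2 * j).+1)%:R =
      2 * ('C((2 * (n + j)).+1, 2 * n)%:R * 'C(2 * n, (n + j).+1)%:R) :> R.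
    rewrite -!natrM bin_central_half -mulnA (@bin_trinomial _ _ _ (2 * n)); last lia.
    by rewrite [(2 * (n + j))%N]mul2n -addnn addSn.
  rewrite arcsine_momentE /wcoef /F.
  transitivity (sqrt PI / 4 ^+ n.+1 * (-1) ^+ (n + j) *
    ('C(2 * (n + j).+1, (n + j).+1)%:R * 'C(n + j, (2 * j).+1)%:R)).
    by rewrite -addSn [4 ^+ (_ + _)]exprD; field; rewrite !p0.
  by rewrite tri; ring.
under eq_bigr => j _ do rewrite E.
rewrite -big_distrr /= (@sum_shift F n B (2 * n)).
(* The term k = 2n vanishes; dropping it gives the range of [altsum_bin_bin_pred], which needs 2n >
   0, so n = 0 is treated apart. *)
- rewrite big_nat_recr //= {2}/F bin_small // mulr0 mul0r addr0.
  case: n {lt_nB E} @F => [|n] /=; first by rewrite big_nil; field.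
  rewrite altsum_bin_bin_pred // eqxx.
  rewrite exprM sqrrN !expr1n exprM.
  have -> : (- 2) ^+ 2 = 4 :> R by ring.
  rewrite [4 ^+ n.+2]exprS.
  by field; rewrite p0.
- lia.
- by move=> k ltk; rewrite /F (@bin_small _.+1) ?mulr0 //; lia.
- by move=> k ltk; rewrite /F bin_small ?mulr0 ?mul0r //; lia.
Qed.

(** * Weights as linear forms *)

Definition word_weight (k : {fmonom bool}) : R :=
  (\prod_(x <- fmonom_val k) letter_weight x)%R.

Definition word_bar_weight (k : {fmonom bool}) : R :=
  if rev (fmonom_val k) is true :: u then word_weight (FMonom (rev u)) else 0%R.

Definition ncwbar (A : ncA) : R := ncw (ncbar A).

Lemma ncwE (A : ncA) : ncw A = mmap idfun word_weight A.
Proof. by []. Qed.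

(** As the linear extension of a function on words, [ncwbar] inherits linearity and its product rule
    from words. *)
Lemma ncwbarE (A : ncA) : ncwbar A = mmap idfun word_bar_weight A.
Proof.
rewrite /ncwbar ncwE /ncbar raddf_sum; apply: eq_bigr => k _.
rewrite /word_bar_weight; case: (rev _) => [|[] u]; last by rewrite raddf0 mulr0.
  by rewrite raddf0 mulr0.
by rewrite /= mmapU.
Qed.

Lemma mmap_idfun_is_linear (h : {fmonom bool} -> R) :
  scalar (mmap idfun h : ncA -> R).
Proof.
move=> c A B; rewrite raddfD; congr (_ + _).
rewrite /= (mmapEw (msuppZ_le _ _)) mmapE big_distrr /=.
by apply: eq_bigr => k _; rewrite mcoeffZ mulrA.
Qed.

Lemma ncw_is_linear : scalar ncw.
Proof. exact: mmap_idfun_is_linear. Qed.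

HB.instance Definition _ := GRing.isLinear.Build R ncA R *%R ncw ncw_is_linear.

Lemma ncwbar_is_linear : scalar ncwbar.
Proof. by move=> c A B; rewrite !ncwbarE mmap_idfun_is_linear. Qed.

HB.instance Definition _ := GRing.isLinear.Build R ncA R *%R ncwbar ncwbar_is_linear.

Lemma mmap_mul (h : {fmonom bool} -> R) (A B : ncA) :
  mmap idfun h (A * B) = \sum_(k1 <- msupp A) \sum_(k2 <- msupp B)
    A@_k1 * B@_k2 * h (mmul k1 k2).
Proof.
rewrite malgME raddf_sum; apply: eq_bigr => k1 _.
by rewrite raddf_sum; apply: eq_bigr => k2 _; rewrite /= mmapU.
Qed.

Lemma word_weightM (k l : {fmonom bool}) :
  word_weight (mmul k l) = word_weight k * word_weight l.
Proof. by rewrite /word_weight fmM big_cat. Qed.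

(** The last letter of the product is that of l, unless l is empty. *)
Lemma word_bar_weightM (k l : {fmonom bool}) :
  word_bar_weight (mmul k l) =
  word_weight k * word_bar_weight l + word_bar_weight k * (l == mone)%:R.
Proof.
have -> : (l == mone) = (fmonom_val l == [::]) by rewrite fmP fm1.
rewrite /word_bar_weight fmM rev_cat; case: l => l /=.
case: (lastP l) => [|l' x]; first by rewrite mulr0 mulr1 add0r.
have -> : (rcons l' x == [::]) = false by case: l'.
rewrite rev_rcons mulr0 addr0 /=; case: x; last by rewrite mulr0.
by rewrite revK rev_cat !revK /word_weight /= big_cat.
Qed.

Lemma ncw1 : ncw 1 = 1.
Proof. by rewrite ncwE mmapU /word_weight fm1 big_nil mulr1. Qed.

Lemma ncwM (A B : ncA) : ncw (A * B) = ncw A * ncw B.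
Proof.
rewrite !ncwE mmap_mul /mmap big_distrl; apply: eq_bigr => k _ /=.
by rewrite big_distrr; apply: eq_bigr => l _ /=; rewrite word_weightM; ring.
Qed.

(** A twisted Leibniz rule: [ncwbar] is a derivation with respect to [ncw] on the left and the
    constant coefficient on the right. *)
Lemma ncwbarM (A B : ncA) :
  ncwbar (A * B) = ncw A * ncwbar B + ncwbar A * B@_mone.
Proof.
have -> : B@_mone = mmap idfun (fun k => (k == mone)%:R) B.
  rewrite {1}[B]monalgE !raddf_sum; apply: eq_bigr => k _ /=.
  by rewrite mcoeffU; case: eqP => _; rewrite ?mulr1 ?mulr0.
rewrite !ncwbarE ncwE mmap_mul /mmap !big_distrl -big_split; apply: eq_bigr => k _ /=.
rewrite !big_distrr -big_split; apply: eq_bigr => l _ /=.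
by rewrite word_bar_weightM; ring.
Qed.

Lemma mcoeff1M (A B : ncA) : (A * B)@_mone = A@_mone * B@_mone.
Proof. exact: (rmorphM (mcoeff mone)). Qed.

Lemma ncw_symN : ncw symN = 2.
Proof. by rewrite ncwE mmapU /word_weight fmU big_seq1 mul1r. Qed.

Lemma ncw_symD : ncw symD = -1.
Proof. by rewrite ncwE mmapU /word_weight fmU big_seq1 mul1r. Qed.

Lemma ncwbar_symN : ncwbar symN = 1.
Proof.
by rewrite ncwbarE mmapU /word_bar_weight fmU /= /word_weight big_nil mulr1.
Qed.

Lemma ncwbar_symD : ncwbar symD = 0.
Proof. by rewrite ncwbarE mmapU /word_bar_weight fmU mulr0. Qed.

Lemma ncwbar1 : ncwbar 1 = 0.
Proof. by rewrite ncwbarE mmapU /word_bar_weight fm1 mulr0. Qed.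

Lemma mcoeff1_symN : symN@_mone = 0.
Proof. by rewrite mcoeffU1 fmP fmU fm1. Qed.

Lemma mcoeff1_symD : symD@_mone = 0.
Proof. by rewrite mcoeffU1 fmP fmU fm1. Qed.

(* Stated over an abstract ring [A]: with [A := ncA], rewriting with a
   multiplicativity lemma unfolds the product of the monoid algebra. *)
Lemma weight_recurrences (A : nzRingType) (w b e : {additive A -> R}) (N D : A) :
  {morph w : x y / x * y} -> {morph e : x y / x * y} ->
  (forall x y, b (x * y) = w x * b y + b x * e y) ->
  w N = 2 -> w D = -1 -> b N = 1 -> b D = 0 -> e N = 0 -> e D = 0 ->
  forall r s t : A, e s = 0 ->
  let r' := - (N * N + D) * r + N * s in
  let s' := D * N * r - D * s + N * t in
  [/\ w r' = - 3 * w r + 2 * w s,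
      w s' = - 2 * w r + w s + 2 * w t,
      2 * b r' + e r' = - 3 * (2 * b r + e r) + 4 * b s - e r
    & b s' = - (2 * b r + e r) + b s + (2 * b t + e t)].
Proof.
(* The value b s' involves r only through 2 b r + e r, which therefore replaces b r as unknown. Its
   coefficient -3 and the remainder - e r come from w (N N + D) = 3 and b (N N + D) = 2. *)
move=> wM eM bM wN wD bN bD eN eD r s t es r' s'; rewrite /r' /s'; split.
- by rewrite raddfD /= !wM raddfN raddfD /= wM wN wD; ring.
- by rewrite raddfD raddfB /= !wM wN wD; ring.
- rewrite !(raddfD, raddfN) /= !(wM, eM, bM) !(raddfD, raddfN) /=.
  by rewrite !(wM, eM, bM) wN wD bN bD eN eD es; ring.
- by rewrite raddfD raddfB /= !bM wM wN wD bN bD eN es; ring.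
Qed.

(** * Closed forms for the weights of R_kj and S_kj *)

Definition prev {V : nmodType} (f : nat -> V) (j : nat) : V :=
  if j is j'.+1 then f j' else 0.

Lemma Rkj0 (j : nat) : Rkj 0 j = (j == 0%N)%:R.
Proof. by case: j. Qed.

Lemma Skj0 (j : nat) : Skj 0 j = 0.
Proof. by case: j. Qed.

Lemma mcoeff1_M0 (A B : ncA) : A@_mone = 0 -> (A * B)@_mone = 0.
Proof. by rewrite mcoeff1M => ->; rewrite mul0r. Qed.

(** For k > 0 every term of the recursion has a left factor without constant term. *)
Lemma mcoeff1_Rkj (k j : nat) : (Rkj k j)@_mone = ((k == 0%N) && (j == 0%N))%:R.
Proof.
case: k => [|k]; first by rewrite Rkj0; case: eqP; rewrite ?mcoeff0 ?mcoeff1 ?eqxx.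
have ND0 : (- (symN * symN + symD))@_mone = 0.
  by rewrite mcoeffN mcoeffD (mcoeff1_M0 symN symN mcoeff1_symN) mcoeff1_symD addr0 oppr0.
have R0 := mcoeff1_M0 _ (Rkj k j) ND0.
have S0 := mcoeff1_M0 _ (Skj k j) mcoeff1_symN.
by apply: etrans (mcoeffD _ _ _) (etrans (congr2 +%R R0 S0) (addr0 0)).
Qed.

Lemma mcoeff1_Skj (k j : nat) : (Skj k j)@_mone = 0.
Proof.
case: k => [|k]; first by rewrite Skj0 mcoeff0.
apply: etrans (mcoeffD _ _ _) _; rewrite mcoeff1_M0 ?mcoeff1_symN // addr0.
apply: etrans (mcoeffB _ _ _) _; rewrite [X in _ - X]mcoeff1_M0 ?mcoeff1_symD // subr0.
by rewrite !mcoeff1_M0 ?mcoeff1_symD.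
Qed.

Lemma RSkj_recurrences (k j : nat) :
  let r := Rkj k j in let s := Skj k j in let t := prev (Rkj k) j in
  [/\ ncw (Rkj k.+1 j) = - 3 * ncw r + 2 * ncw s,
      ncw (Skj k.+1 j) = - 2 * ncw r + ncw s + 2 * ncw t,
      2 * ncwbar (Rkj k.+1 j) + (Rkj k.+1 j)@_mone =
        - 3 * (2 * ncwbar r + r@_mone) + 4 * ncwbar s - r@_mone
    & ncwbar (Skj k.+1 j) =
        - (2 * ncwbar r + r@_mone) + ncwbar s + (2 * ncwbar t + t@_mone)].
Proof.
exact: (@weight_recurrences ncA ncw ncwbar (mcoeff mone) symN symD ncwM mcoeff1M
  ncwbarM ncw_symN ncw_symD ncwbar_symN ncwbar_symD mcoeff1_symN mcoeff1_symD
  (Rkj k j) (Skj k j) (prev (Rkj k) j) (mcoeff1_Skj k j)).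
Qed.

Lemma wcoef0 (j : nat) : wcoef 0 j = 0.
Proof. by rewrite /wcoef mulr0. Qed.

Lemma prev_wcoef0 (j : nat) : prev (wcoef 0) j = 0.
Proof. by case: j => [|j] //=; rewrite wcoef0. Qed.

Lemma wcoef1 (j : nat) : wcoef 1 j = - (j == 0%N)%:R.
Proof.
case: j => [|j]; rewrite /wcoef; first by rewrite expr1 expr0 !mulr1.
by rewrite bin_small ?mulr0 ?oppr0 //; lia.
Qed.

(** The recurrence of the denominator Den = 1 + 2x + x^2 - 4 x^2 y; [prev] is multiplication by
    y. *)
Lemma wcoefSS (k j : nat) :
  wcoef k.+2 j = - 2 * wcoef k.+1 j - wcoef k j + 4 * prev (wcoef k) j.
Proof.
rewrite /prev; case: j => [|j]; rewrite /wcoef.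
  by rewrite !muln0 !bin1 -!natr1 !exprS; ring.
have -> : (2 * j.+1 = (2 * j).+2)%N by lia.
by rewrite !binS !natrD !exprS; ring.
Qed.

Lemma wcoef_weights (r s : nat -> nat -> R) :
  (forall j : nat, r 0%N j = (j == 0%N)%:R) -> (forall j, s 0%N j = 0) ->
  (forall k j, r k.+1 j = - 3 * r k j + 2 * s k j) ->
  (forall k j, s k.+1 j = - 2 * r k j + s k j + 2 * prev (r k) j) ->
  forall k j, r k j = wcoef k j - wcoef k.+1 j /\
              s k j = 2 * (wcoef k j - prev (wcoef k) j).
Proof.
move=> r0 s0 rS sS; elim=> [|k IH] j.
  by rewrite r0 s0 wcoef0 wcoef1 prev_wcoef0; split; ring.
have [IHr IHs] := IH j.
have -> : r k.+1 j = wcoef k.+1 j - wcoef k.+2 j.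
  by rewrite rS IHr IHs wcoefSS; ring.
split=> //; rewrite sS IHr IHs.
have -> : prev (r k) j = prev (wcoef k) j - prev (wcoef k.+1) j.
  by case: (j) => [|j'] /=; [rewrite subrr | have [-> _] := IH j'].
by ring.
Qed.

(** The generating series are (1-x)^2 / Den for t and x (1-x) (y-1) / Den for s. At k = 0 the
    default [0.-1 = 0] is harmless because [wcoef 0 j = 0]. *)
Lemma wcoef_bar_weights (t s : nat -> nat -> R) :
  (forall j : nat, t 0%N j = (j == 0%N)%:R) -> (forall j, s 0%N j = 0) ->
  (forall k j, t k.+1 j = - 3 * t k j + 4 * s k j - ((k == 0%N) && (j == 0%N))%:R) ->
  (forall k j, s k.+1 j = - t k j + s k j + prev (t k) j) ->
  forall k j, t k j = - wcoef k.+1 j + 2 * wcoef k j - wcoef k.-1 j /\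
    s k j = (wcoef k j - wcoef k.-1 j) - (prev (wcoef k) j - prev (wcoef k.-1) j).
Proof.
move=> t0 s0 tS sS; elim=> [|k IH] j.
  by rewrite t0 s0 /= wcoef0 wcoef1 prev_wcoef0; split; ring.
have [IHt IHs] := IH j.
(* The Kronecker term is the numerator of -x / Den, felt only at k = 0; it matches the source term
   of [tS]. *)
have wrec : wcoef k.+1 j = - 2 * wcoef k j - wcoef k.-1 j + 4 * prev (wcoef k.-1) j
    - ((k == 0%N) && (j == 0%N))%:R.
  case: (k) => [|k'] /=; last by rewrite wcoefSS; ring.
  by rewrite wcoef1 !wcoef0 prev_wcoef0; ring.
have -> : t k.+1 j = - wcoef k.+2 j + 2 * wcoef k.+1 j - wcoef k j.
  by rewrite tS IHt IHs wcoefSS wrec; ring.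
split=> //; rewrite sS IHt IHs.
have -> : prev (t k) j =
    - prev (wcoef k.+1) j + 2 * prev (wcoef k) j - prev (wcoef k.-1) j.
  by case: (j) => [|j'] /=; [ring | have [-> _] := IH j'].
by rewrite /=; ring.
Qed.

Lemma prevE (V : nmodType) (W : nmodType) (h : V -> W) (f : nat -> V) (j : nat) :
  h 0 = 0 -> h (prev f j) = prev (h \o f) j.
Proof. by case: j. Qed.

Lemma ncw_RSkj (k j : nat) :
  ncw (Rkj k j) = wcoef k j - wcoef k.+1 j /\
  ncw (Skj k j) = 2 * (wcoef k j - prev (wcoef k) j).
Proof.
apply: (@wcoef_weights (fun k j => ncw (Rkj k j)) (fun k j => ncw (Skj k j))).
- by move=> {}j; rewrite Rkj0; case: eqP; rewrite ?ncw1 ?raddf0.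
- by move=> {}j; rewrite Skj0 raddf0.
- by move=> {}k {}j; have [recR _ _ _] := RSkj_recurrences k j.
- move=> {}k {}j; have [_ recS _ _] := RSkj_recurrences k j.
  by apply: etrans recS _; rewrite (@prevE _ _ ncw) // raddf0.
Qed.

Lemma ncwbar_RSkj (k j : nat) :
  2 * ncwbar (Rkj k j) + (Rkj k j)@_mone =
    - wcoef k.+1 j + 2 * wcoef k j - wcoef k.-1 j /\
  ncwbar (Skj k j) =
    (wcoef k j - wcoef k.-1 j) - (prev (wcoef k) j - prev (wcoef k.-1) j).
Proof.
apply: (@wcoef_bar_weights (fun k j => 2 * ncwbar (Rkj k j) + (Rkj k j)@_mone)
  (fun k j => ncwbar (Skj k j))).
- move=> {}j; rewrite mcoeff1_Rkj Rkj0 /=.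
  by case: eqP; rewrite ?ncwbar1 ?raddf0 mulr0 add0r.
- by move=> {}j; rewrite Skj0 raddf0.
- by move=> {}k {}j; have [_ _ recR _] := RSkj_recurrences k j; rewrite -mcoeff1_Rkj.
- move=> {}k {}j; have [_ _ _ recS] := RSkj_recurrences k j.
  apply: etrans recS _; rewrite -(@prevE _ _ (fun A => 2 * ncwbar A + A@_mone)) //.
  by rewrite raddf0 mcoeff0 mulr0 addr0.
Qed.

(** * Weights of alpha_n and Z_{n+1} *)

Lemma brace_moment (a j : nat) : brace a j%:Z = arcsine_moment (a + j) / gammah a.
Proof. by rewrite /brace /arcsine_moment -PoszD absz_nat RdivE invfM mulrA. Qed.

Lemma brace_moment_pred (a j : nat) :
  brace a.+1 (j%:Z - 1) = arcsine_moment (a + j) / gammah a.+1.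
Proof.
rewrite /brace /arcsine_moment.
have -> : a.+1%:Z + (j%:Z - 1) = (a + j)%N%:Z by lia.
by rewrite absz_nat RdivE invfM mulrA.
Qed.

(** Shifting j by one moves from diagonal n to diagonal n + 1, so n = 0 is no longer exceptional. *)
Lemma sum_moment_wcoef_prev (n : nat) :
  \sum_(0 <= j < n.+2) arcsine_moment (n + j) * prev (wcoef (n + j)) j = - (sqrt PI / 2).
Proof.
rewrite big_nat_recl // mulr0 add0r.
under eq_bigr => j _ do rewrite /= addnS -addSn.
by rewrite sum_moment_wcoef.
Qed.

Lemma sum_moment_pred_wcoef (n B : nat) : (n <= B)%N ->
  \sum_(0 <= j < B) arcsine_moment (n + j) * wcoef (n + j).-1 j =
  if n is 0 then 0 else sqrt PI * (2 / 4 ^+ n - 2^-1).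
Proof.
case: n => [_|n lt_nB]; last exact: sum_moment_wcoef_pred.
by rewrite big1 // => j _; rewrite /wcoef bin_small ?mulr0 //; lia.
Qed.

Lemma sum_moment_pred_wcoef_prev (n : nat) :
  \sum_(0 <= j < n.+2) arcsine_moment (n + j) * prev (wcoef (n + j).-1) j =
  sqrt PI * (2 / 4 ^+ n.+1 - 2^-1).
Proof.
rewrite big_nat_recl // mulr0 add0r.
under eq_bigr => j _ do rewrite /= addnS.
by rewrite sum_moment_wcoef_pred.
Qed.

(** For n > 0 the sums over the diagonals n and n + 1 cancel. For n = 0 the first is zero, and the
    second leaves sqrt(pi) = Gamma(1/2). *)
Lemma ncw_alpha (n : nat) : ncw (alpha n) = (n == 0%N)%:R.
Proof.
apply: (mulfI (gammah_neq0 n)); rewrite /alpha raddf_sum big_distrr /=.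
have E (j : nat) : gammah n * ncw (brace n j *: Skj (n + j) j) =
    2 * (arcsine_moment (n + j) * wcoef (n + j) j)
    - 2 * (arcsine_moment (n + j) * prev (wcoef (n + j)) j).
  rewrite linearZ /= (ncw_RSkj _ _).2 brace_moment.
  by field; exact: gammah_neq0.
under eq_bigr => j _ do rewrite E.
rewrite sumrB -!big_distrr /= sum_moment_wcoef_prev sum_moment_wcoef; last lia.
case: n {E} => [|n]; last by rewrite mulr0; field.
by rewrite /gammah /=; field.
Qed.

Lemma mcoeff1_alpha (n : nat) : (alpha n)@_mone = 0.
Proof.
rewrite /alpha raddf_sum big1 // => j _.
by rewrite /= mcoeffZ mcoeff1_Skj mulr0.
Qed.

(** For n > 0 the constants of the four diagonal sums cancel, leaving -2/4^n + 2/4^(n+1) =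
    -(3/2)/4^n times sqrt(pi). *)
Lemma ncwbar_alpha (n : nat) :
  gammah n * ncwbar (alpha n) = sqrt PI * (2 * (n == 0%N)%:R - 3 / 2 / 4 ^+ n).
Proof.
rewrite /alpha raddf_sum big_distrr /=.
have E (j : nat) : gammah n * ncwbar (brace n j *: Skj (n + j) j) =
    (arcsine_moment (n + j) * wcoef (n + j) j
     - arcsine_moment (n + j) * wcoef (n + j).-1 j)
    - (arcsine_moment (n + j) * prev (wcoef (n + j)) j
     - arcsine_moment (n + j) * prev (wcoef (n + j).-1) j).
  rewrite linearZ /= (ncwbar_RSkj _ _).2 brace_moment.
  by field; exact: gammah_neq0.
under eq_bigr => j _ do rewrite E.
have le_n : (n <= n.+2)%N by lia.
rewrite !sumrB sum_moment_wcoef_prev sum_moment_wcoef // sum_moment_pred_wcoef //.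
rewrite sum_moment_pred_wcoef_prev.
have p0 k : 4 ^+ k != 0 :> R by rewrite expf_neq0 // pnatr_eq0.
case: n {E le_n} => [|n] /=; first by rewrite expr1 expr0; field.
by rewrite !exprS; field; rewrite p0.
Qed.

Lemma ncw_Zop (n : nat) : ncw (Zop n.+1) = 2 * (n == 0%N)%:R.
Proof.
apply: (mulfI (gammah_neq0 n.+1)); rewrite /Zop raddf_sum big_distrr /=.
have E (j : nat) : gammah n.+1 * ncw (brace n.+1 (j%:Z - 1) *: Rkj (n + j) j) =
    arcsine_moment (n + j) * wcoef (n + j) j
    - arcsine_moment (n + j) * wcoef (n + j).+1 j.
  rewrite linearZ /= (ncw_RSkj _ _).1 brace_moment_pred.
  by field; exact: gammah_neq0.
under eq_bigr => j _ do rewrite E.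
rewrite sumrB sum_moment_wcoef // sum_moment_wcoefS // opprK.
case: n {E} => [|n]; last by rewrite !mulr0 addNr.
by rewrite gammahS /gammah /=; field.
Qed.

(** Since n > 0, no R_{n+j,j} has a constant term, and the closed form for 2 [ncwbar] + constant
    coefficient gives the bar weight itself. *)
Lemma ncwbar_Zop (n : nat) : (0 < n)%N ->
  gammah n.+1 * ncwbar (Zop n.+1) = - (sqrt PI / 4 ^+ n).
Proof.
move=> n_gt0; rewrite /Zop raddf_sum big_distrr /=.
have E (j : nat) : gammah n.+1 * ncwbar (brace n.+1 (j%:Z - 1) *: Rkj (n + j) j) =
    (2 * (arcsine_moment (n + j) * wcoef (n + j) j)
     - arcsine_moment (n + j) * wcoef (n + j).+1 j
     - arcsine_moment (n + j) * wcoef (n + j).-1 j) / 2.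
  have [eqR _] := ncwbar_RSkj (n + j) j.
  rewrite mcoeff1_Rkj addn_eq0 (gtn_eqF n_gt0) /= addr0 in eqR.
  have -> : 2 * (arcsine_moment (n + j) * wcoef (n + j) j)
     - arcsine_moment (n + j) * wcoef (n + j).+1 j
     - arcsine_moment (n + j) * wcoef (n + j).-1 j =
     arcsine_moment (n + j) * (2 * ncwbar (Rkj (n + j) j)) by rewrite eqR; ring.
  by rewrite linearZ /= brace_moment_pred; field; exact: gammah_neq0.
under eq_bigr => j _ do rewrite E.
rewrite -big_distrl /= !sumrB -big_distrr /=.
rewrite sum_moment_wcoef // sum_moment_wcoefS // sum_moment_pred_wcoef //.
have p0 k : 4 ^+ k != 0 :> R by rewrite expf_neq0 // pnatr_eq0.
by case: n n_gt0 {E} => [|n] //= _; field; rewrite p0.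
Qed.

(** * Heat content operators *)

Lemma size_Dall (n : nat) : size (Dall n) = (2 * n).+1.
Proof. by elim: n => //= n IH; rewrite !size_rcons IH; lia. Qed.

Lemma nth_Dall (n m i : nat) : (i < (2 * n).+1)%N ->
  nth 0 (Dall (m + n)) i = nth 0 (Dall n) i.
Proof.
move=> lt_i; elim: m => //= m <-.
have lt_size : (i < size (Dall (m + n)))%N by rewrite size_Dall; lia.
by rewrite !nth_rcons !size_rcons lt_size ltnS (ltnW lt_size).
Qed.

(** The lists [Dall] extend one another, so any sufficiently long one may be read. *)
Lemma DopE (n k : nat) : (0 < k <= (2 * n).+1)%N -> Dop k = nth 0 (Dall n) k.-1.
Proof.
move=> k_bound; rewrite /Dop.
have [le_kn|lt_nk] := leqP k n.
  by rewrite -(subnK le_kn) nth_Dall //; lia.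
by rewrite -(subnK (ltnW lt_nk)) nth_Dall //; lia.
Qed.

Lemma Dop1 : Dop 1 = (2 / sqrt PI) *: 1.
Proof. by rewrite (@DopE 0). Qed.

Lemma Dop_even (n : nat) :
  Dop (2 * n).+2 = (sqrt PI)^-1 *: \sum_(0 <= i < n.+1)
    ((gammah i.+1 * gammah (n - i)) / (n.+1`!)%:R) *:
      (Dop (2 * i).+1 * alpha (n - i)).
Proof.
rewrite (@DopE n.+1) /=; last lia.
rewrite nth_rcons size_rcons size_Dall ltnSn nth_rcons size_Dall ltnn eqxx.
rewrite big_add1; apply: (congr1 ( *:%R _)); apply: eq_big_nat => i /andP[_ lt_in].
rewrite subSS (@DopE n); last lia.
by have -> : (2 * i.+1 - 2 = (2 * i).+1.-1)%N by lia.
Qed.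

Lemma Dop_odd (n : nat) :
  Dop (2 * n).+3 = (sqrt PI)^-1 *: Zop n.+2 +
    (sqrt PI)^-1 *: \sum_(0 <= i < n.+1)
      (((i.+1`!)%:R * gammah (n - i)) / gammah n.+2) *:
        (Dop (2 * i).+2 * alpha (n - i)).
Proof.
rewrite (@DopE n.+1) /=; last lia.
rewrite nth_rcons size_rcons size_Dall ltnn eqxx.
rewrite big_add1; apply: (congr1 (fun x => _ + _ *: x)).
apply: eq_big_nat => i /andP[_ lt_in].
rewrite subSS (@DopE n.+1) /=; last lia.
rewrite [in RHS]nth_rcons size_rcons size_Dall ifT; last lia.
by have -> : (2 * i.+1 - 1 = (2 * i).+1)%N by lia.
Qed.

Lemma linear_form_affine (f : {scalar ncA}) (c a b : R) (A B : ncA) :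
  f A = a -> f B = b -> f (c *: A + c *: B) = c * (a + b).
Proof. by move=> <- <-; rewrite -scalerDr linearZ raddfD. Qed.

Lemma ncwZM (c : R) (A B : ncA) : ncw (c *: (A * B)) = c * (ncw A * ncw B).
Proof. by rewrite linearZ /= ncwM. Qed.

Lemma ncwbarZM (c : R) (A B : ncA) : B@_mone = 0 ->
  ncwbar (c *: (A * B)) = c * (ncw A * ncwbar B).
Proof. by move=> B0; rewrite linearZ /= ncwbarM B0 mulr0 addr0. Qed.

Lemma sum_ncw_alpha (n : nat) (c : nat -> R) (A : nat -> ncA) :
  ncw (\sum_(0 <= i < n.+1) c i *: (A i * alpha (n - i))) = c n * ncw (A n).
Proof.
rewrite raddf_sum big_nat_recr //= big_nat_cond big1 => [|i].
  by rewrite add0r ncwZM subnn ncw_alpha mulr1.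
by case/andP=> /andP[_ lt_in] _; rewrite ncwZM ncw_alpha subn_eq0 leqNgt lt_in !mulr0.
Qed.

(** As [alpha] has no constant term, only w(A_i) times the bar weight of alpha_{n-i} remains. The
    assumption supplies the Gamma factor of [ncwbar_alpha], and the constant 2 there is the full sum
    of (3/2) 4^-m, so only the geometric tail is left. *)
Lemma sum_ncwbar_alpha (n : nat) (c : nat -> R) (A : nat -> ncA) (d : R) :
  (forall i, c i * ncw (A i) = d * gammah (n - i)) ->
  ncwbar (\sum_(0 <= i < n.+1) c i *: (A i * alpha (n - i))) =
  d * (sqrt PI * 2 / 4 ^+ n.+1).
Proof.
move=> cA; rewrite raddf_sum /=.
under eq_bigr => i _ do
  rewrite ncwbarZM ?mcoeff1_alpha // mulrA cA -mulrA ncwbar_alpha.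
rewrite -big_distrr /=; congr (_ * _).
rewrite big_nat_rev /= add0n.
under eq_big_nat => i /andP[_ lt_in] do rewrite subSS subKn //.
have p0 k : 4 ^+ k != 0 :> R by rewrite expf_neq0 // pnatr_eq0.
elim: n {cA} => [|n IH]; first by rewrite big_nat1 /= expr0 expr1; field.
by rewrite big_nat_recr // [LHS]/= IH !exprS; field; rewrite p0.
Qed.

(** Only the last summand, containing alpha_0, has nonzero weight, and Z_{n+2} has weight zero; so
    each weight follows from the preceding one. *)
Lemma ncw_Dop (n : nat) :
  ncw (Dop (2 * n).+1) = (gammah n.+1)^-1 /\ ncw (Dop (2 * n).+2) = (n.+1`!)%:R^-1.
Proof.
have even k : ncw (Dop (2 * k).+1) = (gammah k.+1)^-1 ->
    ncw (Dop (2 * k).+2) = (k.+1`!)%:R^-1.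
  move=> IH; rewrite Dop_even linearZ /= sum_ncw_alpha IH subnn.
  have := fact_neq0 k.+1; have := gammah_neq0 k.+1; have := sqrt_PI_neq0.
  by rewrite [gammah 0]/gammah => h1 h2 h3; field; rewrite h1 h2 h3.
elim: n => [|n [_ IH]]; last first.
  have odd_n : ncw (Dop (2 * n.+1).+1) = (gammah n.+2)^-1.
    have -> : ((2 * n.+1).+1 = (2 * n).+3)%N by lia.
    rewrite Dop_odd.
    apply: etrans (@linear_form_affine ncw _ _ _ _ _ (ncw_Zop _) (sum_ncw_alpha _ _ _)) _.
    rewrite IH subnn /=.
    have := fact_neq0 n.+1; have := gammah_neq0 n.+2; have := sqrt_PI_neq0.
    by rewrite [gammah 0]/gammah => h1 h2 h3; field; rewrite h1 h2 h3.
  by split=> //; exact: even.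
have odd_0 : ncw (Dop (2 * 0).+1) = (gammah 1)^-1.
  rewrite muln0 Dop1 linearZ /= ncw1 gammahS [gammah 0]/gammah.
  by have h := sqrt_PI_neq0; field; rewrite h.
by split=> //; exact: even.
Qed.

Lemma ncwbar_Dop_even (n : nat) :
  ncwbar (Dop (2 * n).+2) = 2 / (4 ^+ n.+1 * (n.+1`!)%:R).
Proof.
rewrite Dop_even linearZ /= (@sum_ncwbar_alpha _ _ _ (n.+1`!)%:R^-1) => [|i].
  have h1 := fact_neq0 n.+1; have h2 := sqrt_PI_neq0.
  have h3 : 4 ^+ n.+1 != 0 :> R by rewrite expf_neq0 // pnatr_eq0.
  by field; rewrite h1 h2 h3.
rewrite (ncw_Dop i).1; have h1 := fact_neq0 n.+1; have h2 := gammah_neq0 i.+1.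
by field; rewrite h1 h2.
Qed.

(** Up to the factor 1 / (4^(n+1) Gamma(n+5/2)), Z_{n+2} contributes -1 and the sum contributes
    2. *)
Lemma ncwbar_Dop_odd (n : nat) :
  ncwbar (Dop (2 * n).+3) = (4 ^+ n.+1 * gammah n.+2)^-1.
Proof.
have h1 := gammah_neq0 n.+2; have h2 := sqrt_PI_neq0.
have h3 : 4 ^+ n.+1 != 0 :> R by rewrite expf_neq0 // pnatr_eq0.
have eZ : ncwbar (Zop n.+2) = - (sqrt PI / 4 ^+ n.+1) / gammah n.+2.
  by rewrite -ncwbar_Zop // mulrAC mulfV // mul1r.
rewrite Dop_odd.
apply: etrans (@linear_form_affine ncwbar _ _ _ _ _ eZ
  (@sum_ncwbar_alpha _ _ _ (gammah n.+2)^-1 _)) _ => [i|]; last first.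
  by field; rewrite h1 h2 h3.
rewrite (ncw_Dop i).2; have h4 := fact_neq0 i.+1.
by field; rewrite h1 h4.
Qed.

(** * Double factorials and the final formulas *)

Lemma gammah_dfact (n : nat) :
  gammah n.+1 = sqrt PI * (dfact (2 * n).+1)%:R / 2 ^+ n.+1.
Proof.
have p0 k : 2 ^+ k != 0 :> R by rewrite expf_neq0 // pnatr_eq0.
elim: n => [|n IH]; first by rewrite gammahS muln0 /gammah /= expr1; field.
rewrite gammahS IH.
have -> : dfact (2 * n.+1).+1 = ((2 * n).+3 * dfact (2 * n).+1)%N.
  by have -> : ((2 * n.+1).+1 = (2 * n).+3)%N by lia.
have -> : ((2 * n).+3 = 2 * n.+1 + 1)%N by lia.
by rewrite natrM natrD natrM !exprS; field; rewrite p0.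
Qed.

Lemma dfact_gt0 (n : nat) : (0 < dfact n)%N.
Proof.
suff: ((0 < dfact n) && (0 < dfact n.+1))%N by case/andP.
by elim: n => // n /andP[h1 h2]; rewrite h2 /= muln_gt0 h1.
Qed.

Theorem theorem4p3 :
  (forall n : nat, (1 <= n)%N ->
     ncw (ncbar (Dop (2 * n))) = 2 / ((4 ^ n)%N%:R * (n`!)%:R)
  /\ ncw (ncbar (Dop (2 * n + 1)))
       = (sqrt PI)^-1 * (((2 ^ (n - 1)) * dfact (2 * n + 1))%N%:R)^-1)
  /\ (forall k : nat, (2 <= k)%N -> ncw (ncbar (Dop k)) <> 0).
Proof.
have p0 m k : m.+1%:R ^+ k != 0 :> R by rewrite expf_neq0 // pnatr_eq0.
split=> [[//|n] _|k k_ge2].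
  split.
    have -> : (2 * n.+1 = (2 * n).+2)%N by lia.
    by rewrite -[ncw _]/(ncwbar _) ncwbar_Dop_even natrX.
  have -> : (2 * n.+1 + 1 = (2 * n).+3)%N by lia.
  rewrite -[ncw _]/(ncwbar _) ncwbar_Dop_odd gammah_dfact.
  have -> : ((2 * n.+1).+1 = (2 * n).+3)%N by lia.
  rewrite subn1 -[n.+1.-1]/n natrM natrX.
  (* Dividing 4^(n+1) by the 2^(n+2) coming from Gamma(n+5/2) leaves 2^n. *)
  have -> : 4 ^+ n.+1 = 2 ^+ n.+1 * 2 ^+ n.+1 :> R by rewrite -exprMn -natrM.
  have d0 : (dfact (2 * n).+3)%:R != 0 :> R by rewrite pnatr_eq0 -lt0n dfact_gt0.
  have := sqrt_PI_neq0; have := p0 1%N n.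
  by rewrite !exprS => h1 h2; field; rewrite h1 h2 d0.
apply/eqP; rewrite -[ncw _]/(ncwbar _).
have [odd_k|even_k] := boolP (odd k).
  have -> : (k = (2 * (k./2).-1).+3)%N by lia.
  by rewrite ncwbar_Dop_odd invr_eq0 mulf_neq0 ?p0 ?gammah_neq0.
have -> : (k = (2 * (k./2).-1).+2)%N by lia.
by rewrite ncwbar_Dop_even mulf_neq0 ?invr_eq0 ?mulf_neq0 ?p0 ?fact_neq0 // pnatr_eq0.
Qed.
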